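(* Let $G$ be a finite non-solvable group. Then the set $$\{P(G,w)\mid w\in F_{\infty}\}$$ accumulates in $0$, i.e. $0$ is an accumulation point of this set.
   Context: $F_n$ denotes the free group on $n$ letters and $F_\infty$ the free group on countably infinitely many letters (so every $w\in F_\infty$ lies in some $F_n$). For a finite group $G$ and $w\in F_{n}$, $P(G,w)$ denotes the probability that for $n$ independent uniform random elements $g_{1},\ldots,g_{n}\in G$ we have $w(g_{1},\ldots,g_{n})=1$, i.e. $P(G,w)=|\{(g_1,\ldots,g_n)\in G^n : w(g_1,\ldots,g_n)=1\}|/|G|^n$; this depends only on the word $w$ and not on the choice of $n$, so it is defined for all $w\in F_\infty$. *)

(* Defs.v *)
From HB Require Import structures.
From mathcomp Require Import all_boot all_order all_algebra all_fingroup.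

Set Implicit Arguments.
Unset Strict Implicit.
Unset Printing Implicit Defensive.

Import GRing.Theory Num.Theory.
Local Open Scope group_scope.

(* A letter is a pair (x, b): the generator x if b = false, and its formal
   inverse if b = true. *)
Definition letter_inv (X : Type) (l : X * bool) : X * bool := (l.1, ~~ l.2).

Lemma letter_invK (X : Type) : involutive (@letter_inv X).
Proof. by case=> x b; rewrite /letter_inv /= negbK. Qed.

Definition reduced (X : eqType) (s : seq (X * bool)) : bool :=
  sorted (fun l m => m != letter_inv l) s.

(* The free group on X, in its reduced word model. *)
Record free_group (X : choiceType) := FreeWord {
  letters :> seq (X * bool);
  lettersP : reduced letters }.

HB.instance Definition _ (X : choiceType) := [isSub for @letters X].
HB.instance Definition _ (X : choiceType) := [Choice of free_group X by <:].

Section FreeGroup.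
Variable X : choiceType.
Implicit Types (l m : X * bool) (s t u : seq (X * bool)) (w : free_group X).

(* Left multiplication of a reduced word by one letter. *)
Definition push l s :=
  if s is m :: t then if m == letter_inv l then t else l :: s else [:: l].

Lemma reduced_push l s : reduced s -> reduced (push l s).
Proof.
case: s => [|m s] //= red_s; case: ifP => [_|/negbT ml]; first exact: path_sorted red_s.
by rewrite /reduced /= ml.
Qed.

Lemma reduced_foldr s t : reduced t -> reduced (foldr push t s).
Proof. by move=> red_t; elim: s => //= l s; apply: reduced_push. Qed.

Lemma pushK l s : reduced s -> push l (push (letter_inv l) s) = s.
Proof.
case: s => [|m s] /=; first by rewrite eqxx.
rewrite letter_invK; case: eqP => [->|_ _] /=; last by rewrite eqxx.
by case: s => [|p s] //= /andP[/negPf->].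
Qed.

Lemma foldr_push l s t :
  reduced t -> foldr push t (push l s) = push l (foldr push t s).
Proof.
move=> red_t; case: s => [|m s] //=; case: eqP => [->|//].
by rewrite pushK ?reduced_foldr.
Qed.

Lemma foldr_reduced s : reduced s -> foldr push [::] s = s.
Proof.
elim: s => //= l s IHs red_s; rewrite IHs; last exact: path_sorted red_s.
by case: s red_s {IHs} => //= m s /andP[/negPf->].
Qed.

Definition word_inv s := rev (map (@letter_inv X) s).

Lemma reduced_inv s : reduced s -> reduced (word_inv s).
Proof.
rewrite /reduced /word_inv rev_sorted sorted_map; apply: sub_sorted => l m /=.
by rewrite letter_invK eq_sym.
Qed.

Lemma word_invK : involutive word_inv.
Proof. by move=> s; rewrite /word_inv map_rev revK mapK //; apply: letter_invK. Qed.

Lemma foldr_word_inv s t : foldr push (s ++ t) (word_inv s) = t.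
Proof.
elim: s => //= l s IHs.
by rewrite /word_inv /= rev_cons foldr_rcons /= letter_invK eqxx.
Qed.

Definition free_one : free_group X := @FreeWord X [::] isT.
Definition free_mul w1 w2 := FreeWord (reduced_foldr w1 (lettersP w2)).
Definition free_inv w := FreeWord (reduced_inv (lettersP w)).

Lemma free_mulA : associative free_mul.
Proof.
move=> w1 w2 w3; apply: val_inj => /=.
elim: (letters w1) => //= l s ->; rewrite foldr_push //; exact: lettersP.
Qed.

Lemma free_mul1 : left_id free_one free_mul.
Proof. by move=> w; apply: val_inj. Qed.

Lemma free_mulr1 : right_id free_one free_mul.
Proof. by move=> w; apply: val_inj; rewrite /= foldr_reduced ?lettersP. Qed.

Lemma free_mulV : left_inverse free_one free_inv free_mul.
Proof.
by move=> w; apply: val_inj; rewrite /= -[X in foldr _ X _]cats0 foldr_word_inv.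
Qed.

Lemma free_mulrV : right_inverse free_one free_inv free_mul.
Proof.
move=> w; rewrite -(free_mulV (free_inv w)); congr free_mul.
by apply: val_inj; rewrite /= word_invK.
Qed.

HB.instance Definition _ := isGroup.Build (free_group X)
  free_mulA free_mul1 free_mulr1 free_mulV free_mulrV.

Definition free_gen (x : X) : free_group X := @FreeWord X [:: (x, false)] isT.

Section Eval.
Variables (H : groupType) (f : X -> H).

Definition letter_eval l : H := if l.2 then (f l.1)^-1 else f l.1.

(* The value w(f) of w when every generator x is replaced by f x. *)
Definition word_eval w : H := \prod_(l <- letters w) letter_eval l.

Lemma letter_evalV l : letter_eval (letter_inv l) = (letter_eval l)^-1.
Proof. by case: l => x [] //=; rewrite /letter_eval /= invgK. Qed.

Lemma prod_push l s :
  \prod_(m <- push l s) letter_eval m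
    = letter_eval l * \prod_(m <- s) letter_eval m.
Proof.
case: s => [|m s] /=; first by rewrite big_seq1 big_nil mulg1.
case: eqP => [->|_]; last by rewrite big_cons.
by rewrite big_cons letter_evalV mulgA mulgV mul1g.
Qed.

Lemma word_evalM : {morph word_eval : w1 w2 / w1 * w2}.
Proof.
move=> w1 w2; rewrite /word_eval /=.
elim: (letters w1) => [|l s IHs] /=; first by rewrite big_nil mul1g.
by rewrite prod_push IHs big_cons mulgA.
Qed.

Lemma word_eval1 : word_eval 1 = 1.
Proof. exact: big_nil. Qed.

HB.instance Definition _ :=
  isUMagmaMorphism.Build (free_group X) H word_eval (word_eval1, word_evalM).

Lemma word_eval_gen x : word_eval (free_gen x) = f x.
Proof. exact: big_seq1. Qed.

(* With word_evalM and word_eval_gen: the universal property. *)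
Lemma word_eval_uniq (h : UMagmaMorphism.type (free_group X) H) :
  (forall x, h (free_gen x) = f x) -> h =1 word_eval.
Proof.
move=> hf [s red_s]; rewrite /word_eval /=.
elim: s red_s => [|[x b] s IHs] red_s.
  have -> : FreeWord red_s = 1 by apply: val_inj.
  by rewrite big_nil gmulf1.
have red_s' : reduced s by apply: path_sorted red_s.
pose a : free_group X := if b then (free_gen x)^-1 else free_gen x.
have -> : FreeWord red_s = a * FreeWord red_s'.
  apply: val_inj; rewrite /a /=.
  case: b red_s {a} => red_s /=;
    by case: s red_s {IHs red_s'} => //= m s /andP[/negPf->].
rewrite gmulfM IHs big_cons /a /letter_eval /=.
by case: (b); rewrite ?gmulfV hf.
Qed.

End Eval.
End FreeGroup.

Definition F_infty : Type := free_group nat.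
HB.instance Definition _ := Group.on F_infty.

(* F_n is the subgroup of F_infty of words in the generators 0, ..., n - 1. *)
Definition in_F (n : nat) (w : F_infty) : bool :=
  all (fun l : nat * bool => (l.1 < n)%N) (letters w).

(* The least n such that w lies in F_n. *)
Definition word_rank (w : F_infty) : nat := \max_(l <- letters w) l.1.+1.

Lemma in_F_rank n w : in_F n w = (word_rank w <= n)%N.
Proof.
apply/allP/bigmax_leqP_seq => [le_n l lw _|le_n l lw]; first exact: le_n.
exact: (le_n l lw isT).
Qed.

Section WordProbability.
Variables (R : numFieldType) (gT : finGroupType) (G : {set gT}).

(* The solutions g in G^n of w(g) = 1; the value 1 given to the letters of
   index >= n is irrelevant when w lies in F_n. *)
Definition word_solutions n (w : F_infty) : {set n.-tuple gT} :=
  [set g : n.-tuple gT | all [in G] g & word_eval (nth 1 g) w == 1].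

Definition word_prob_n n (w : F_infty) : R :=
  (#|word_solutions n w|%:R / (#|G| ^ n)%:R)%R.

(* P(G, w); by word_prob_nE any n with w in F_n may replace word_rank w. *)
Definition word_prob (w : F_infty) : R := word_prob_n (word_rank w) w.

Lemma card_word_solutionsS n w :
  in_F n w -> #|word_solutions n.+1 w| = (#|G| * #|word_solutions n w|)%N.
Proof.
move=> Fnw; pose h (p : gT * n.-tuple gT) := [tuple of rcons p.2 p.1].
have inj_h : injective h.
  move=> [a s] [b t] /(congr1 val)/= /rcons_inj[st ->].
  by congr (_, _); apply: val_inj.
rewrite -cardsX -(card_imset _ inj_h); congr #|pred_of_set _|.
have evalE (g : n.-tuple gT) a :
    word_eval (nth 1 (rcons g a)) w = word_eval (nth 1 g) w.
  rewrite /word_eval big_seq [RHS]big_seq; apply: eq_bigr => l /(allP Fnw) ltn.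
  by rewrite /letter_eval nth_rcons size_tuple ltn.
apply/setP=> g; apply/idP/imsetP => [|[[a s] /setXP[Ga]]]; last first.
  by rewrite !inE => /andP[Gs w1] ->; rewrite /= all_rcons Ga Gs evalE.
rewrite inE; case/tupleP: g => x t; set g := [tuple of x :: t].
have sz : size (belast x t) == n by rewrite size_belast size_tuple.
have gE : val g = rcons (Tuple sz) (last x t) by rewrite /= -lastI.
rewrite gE all_rcons evalE => /andP[/andP[Ga Gs] w1].
exists (last x t, Tuple sz); last exact: val_inj.
by apply/setXP; split; rewrite // inE Gs.
Qed.

End WordProbability.

Lemma word_prob_nE (R : numFieldType) (gT : finGroupType) (G : {group gT}) n w :
  in_F n w -> word_prob_n R G n w = word_prob R G w.
Proof.
rewrite in_F_rank => /subnK <-; elim: (n - _)%N => // k IHk.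
rewrite addSn -IHk /word_prob_n card_word_solutionsS; last first.
  by rewrite in_F_rank leq_addl.
have Gn0 : (#|G|%:R != 0 :> R)%R by rewrite pnatr_eq0 -lt0n cardG_gt0.
by rewrite expnS !natrM -mulf_div divff // mul1r.
Qed.

(* Main.v *)
Require Import Defs.
From mathcomp Require Import all_classical all_reals all_analysis.
From mathcomp Require Import all_boot all_order all_algebra all_fingroup all_solvable.
Import numFieldNormedType.Exports.
Import Order.TTheory GRing.Theory Num.Theory GroupScope.

Set Implicit Arguments.
Unset Strict Implicit.

(** P(G, w) is never 0, because the trivial tuple is a solution of every word,
    so it suffices to make P(G, w) arbitrarily small. The idea is that one word
    can detect non-solvability of all tuples at once: for every n there is a word
    w in n letters such that w(g) = 1 forces g_1, ..., g_n to generate a solvable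
    subgroup [nonsolvable_detecting_word]. As G itself is not solvable, the
    solutions of w in G^n are tuples that fail to generate G. Those lie in the
    boxes A^n with A a proper subgroup of G, each of which has density at most
    2^-n [card_nongenerating_tuples]; hence P(G, w) is at most c / 2^n, where c
    bounds the number of subgroups.

    To find the word, let H be the subgroup of the power of the ambient group
    indexed by all n-tuples that is generated by the n coordinate functions:
    its elements are the functions g |-> w(g), and its projection at g is the
    group generated by g. Let M be the last term of the derived series of H. It
    is perfect, and a finite perfect group is the normal closure of a single
    element m [perfect_normal_closure]. If the component of m at g is 1, then so
    is the component at g of all of M, which says that a term of the derived
    series of the group generated by g is trivial. *)

(** * Perfect groups *)

(** By induction, modulo a minimal normal subgroup N the group M is the normal
    closure of the image of some x. Let z be x or any other lift of that image.
    Its normal closure L satisfies N L = M, so L = M as soon as N lies in L;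
    otherwise L meets N trivially, hence centralises it. So a lift that does not
    centralise N is a suitable element, and if x centralises N, then multiplying
    x by a non-central element of N gives one. When N is abelian there is no such
    element, but then M / L, with L the normal closure of x, is a quotient of N, hence
    abelian, and L = M by perfection. *)
Lemma perfect_normal_closure (gT : finGroupType) (M : {group gT}) :
  [~: M, M] = M -> exists2 m, m \in M & <<m ^: M>> = M.
Proof.
have [k] := ubnP #|M|; elim: k gT M => // k IHk gT M /ltnSE-leMk perfM.
have [M1|ntM] := eqVneq (M : {set gT}) 1.
  by exists 1; rewrite ?group1 // M1 class1G genGid.
have [N minN sNM] := minnormal_exists ntM (normG M).
have [/andP[ntN nNM] Nmin] := mingroupP minN.
have perfMN : [~: M / N, M / N] = M / N by rewrite -quotientR // perfM.
have [] := IHk _ (M / N)%G _ perfMN.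
  exact: leq_trans (ltn_quotient ntN sNM) leMk.
move=> _ /morphimP[x nNx Mx ->] gen_x.
have norm_cl z : M \subset 'N(<<z ^: M>>) by rewrite norms_gen ?class_norm.
have sub_cl z : z \in M -> <<z ^: M>> \subset M.
  by move=> Mz; rewrite gen_subG class_subG.
have mul_cl z : z \in M -> coset N z = coset N x -> N * <<z ^: M>> = M.
  move=> Mz zx; have nNcl := subset_trans (sub_cl z Mz) nNM.
  have sclN : z ^: M \subset 'N(N) by rewrite -gen_subG.
  rewrite -quotientK // quotient_gen // quotient_class ?(subsetP nNM) // zx.
  by rewrite gen_x quotientGK // /normal sNM.
have cl_or_cent z :
  z \in M -> coset N z = coset N x -> <<z ^: M>> = M \/ z \in 'C(N).
  move=> Mz zx; have [sNcl|nsNcl] := boolP (N \subset <<z ^: M>>).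
    by left; rewrite -[RHS](mul_cl z) // mulSGid.
  right; have tiNcl : <<z ^: M>> :&: N = 1.
    apply: contraNeq nsNcl => ntI.
    rewrite -{1}(Nmin (<<z ^: M>> :&: N)%G) ?subsetIl ?subsetIr //.
    by apply/andP; split; [exact: ntI | exact: normsI (norm_cl z) nNM].
  have zcl : z \in <<z ^: M>> by rewrite mem_gen ?class_refl.
  apply: (subsetP (_ : <<z ^: M>> \subset 'C(N))) zcl.
  rewrite (sameP commG1P trivgP) -tiNcl commg_subI // subsetI subxx //=.
    exact: subset_trans (sub_cl z Mz) nNM.
  exact: subset_trans sNM (norm_cl z).
case: (cl_or_cent x) => // [|cNx]; first by exists x.
have [abN|] := boolP (abelian N).
  exists x => //; apply/eqP; rewrite eqEsubset sub_cl //=.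
  have: M^`(1) \subset <<x ^: M>>; last by rewrite derg1 perfM.
  have MclE : M / <<x ^: M>> = N / <<x ^: M>>.
    by rewrite -[RHS]quotientMidr /= mul_cl.
  by rewrite der1_min //= MclE quotient_abelian.
case/subsetPn=> y Ny ncNy; have My := subsetP sNM y Ny.
have Mxy : x * y \in M by rewrite groupM.
have xyx : coset N (x * y) = coset N x.
  by rewrite morphM ?(subsetP nNM) //= (coset_id Ny) mulg1.
exists (x * y) => //; case: (cl_or_cent (x * y)) => //.
by rewrite groupMl // (negPf ncNy).
Qed.

Lemma stable_derived (gT : finGroupType) (G : {group gT}) :
  exists d, G^`(d.+1) = G^`(d).
Proof.
have [k] := ubnP #|G|; elim: k G => // k IHk G /ltnSE-leGk.
have [perfG|/negP properG] := boolP (G \subset G^`(1)).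
  by exists 0; apply/eqP; rewrite eqEsubset der_sub.
have [|d dE] := IHk (G^`(1))%G.
  by apply: leq_trans leGk; rewrite proper_card // properE der_sub; apply/negP.
by exists d.+1; move: dE; rewrite /derived_at /= -!iterSr.
Qed.

(** * Words and the group of word functions *)

Section CoordinateGroup.
Variables (n : nat) (gT : finGroupType).

(** The dependent finite function type carries the pointwise group structure. *)
Definition coordinate (k : 'I_n) : {dffun forall _ : n.-tuple gT, gT} :=
  [ffun g => tnth g k].

Definition coordinate_group := <<[set coordinate k | k : 'I_n]>>%G.

(** In a finite group inverses are powers, so positive words suffice; these are
    automatically reduced. *)
Lemma word_of_coordinate_group h :
    h \in coordinate_group ->
  exists2 w : F_infty, in_F n w &
    forall g : n.-tuple gT, word_eval (nth 1 g) w = h g.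
Proof.
case/gen_prodgP=> r [c c_gen ->].
have /fin_all_exists [k kE] j : exists k, c j = coordinate k.
  by case/imsetP: (c_gen j) => k _ ->; exists k.
pose s := [seq (val (k j), false) | j <- index_enum (ordinal r)].
have red_s : reduced s.
  rewrite /reduced /s sorted_map; elim: (index_enum _) => //= a [//|b l] /= ->.
  by rewrite /letter_inv xpair_eqE andbF.
exists (FreeWord red_s : F_infty) => [|g].
  by apply/allP=> _ /mapP[j _ ->] /=.
rewrite /word_eval big_map.
rewrite (big_morph _ (@dffunM _ (fun=> gT) g) (_ : _ = 1)) ?ffunE //.
by apply: eq_bigr => j _; rewrite kE ffunE /letter_eval (tnth_nth 1).
Qed.

Lemma coordinate_group_eval (g : n.-tuple gT) :
  @dffun_morphism _ (fun=> gT) g @* coordinate_group = <<[set x in g]>>.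
Proof.
rewrite morphim_gen ?subsetT // morphimEsub ?subsetT //; congr <<_>>.
rewrite -imset_comp; apply/setP=> x; rewrite inE; apply/imsetP/tnthP.
  by case=> k _ ->; exists k; rewrite /= ffunE.
by case=> k ->; exists k; rewrite //= ffunE.
Qed.

(** The word is the one whose function generates, as a normal subgroup, the last
    term M of the derived series of the coordinate group. Where this function is
    trivial, so is all of M, and evaluation at g maps M onto a term of the derived
    series of the group generated by g. *)
Lemma nonsolvable_detecting_word :
  exists2 w : F_infty, in_F n w &
    forall g : n.-tuple gT,
      word_eval (nth 1 g) w = 1 -> solvable <<[set x in g]>>.
Proof.
pose H := coordinate_group; have [d dE] := stable_derived H.
have [m Mm gen_m] := @perfect_normal_closure _ H^`(d)%G dE.
have [w wn wE] := word_of_coordinate_group (subsetP (der_sub d H) m Mm).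
exists w => // g; rewrite wE => mg1.
rewrite -coordinate_group_eval; apply/derivedP; exists d.
rewrite -morphim_der ?subsetT // -gen_m morphim_gen ?subsetT //.
by rewrite morphim_class ?subsetT ?inE //= mg1 class1G genGid.
Qed.

End CoordinateGroup.

(** * Counting tuples *)

Lemma card_tuples_in (T : finType) n (A : {set T}) :
  #|[set t : n.-tuple T | all [in A] t]| = (#|A| ^ n)%N.
Proof.
have inj_f : injective (map_tuple (val : {x | x \in A} -> T) : n.-tuple _ -> _).
  by move=> s t /(congr1 val)/(inj_map val_inj)/val_inj.
rewrite -[#|A|]card_sig -card_tuple -(card_imset _ inj_f).
apply: eq_card => t; rewrite inE; apply/idP/imsetP => [At | [u _ ->]].
  have sz : size (pmap (insub : T -> option {x | x \in A}) t) == n.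
    by rewrite size_pmap_sub; move: At; rewrite all_count size_tuple.
  exists (Tuple sz) => //; apply: val_inj; rewrite /= (pmap_filter (insubK _)).
  by apply/esym/all_filterP; apply: sub_all At => x Ax; rewrite insubT.
by rewrite all_map; apply/allP=> -[x Ax] _ /=.
Qed.

(** Sort the tuples by the subgroup A that they generate: a proper subgroup has
    index at least 2, so at most (|G| / 2)^n of them generate A. *)
Lemma card_nongenerating_tuples (gT : finGroupType) (G : {group gT}) n :
  (#|[set g : n.-tuple gT | all [in G] g & <<[set x in g]>> != G]| * 2 ^ n
    <= #|{: {group gT}}| * #|G| ^ n)%N.
Proof.
set S := [set g | _]; rewrite -sum1_card.
rewrite (partition_big (fun g : n.-tuple gT => <<[set x in g]>>%G)
  (fun A : {group gT} => A \proper G)) /=; last first.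
  move=> g; rewrite inE properEneq => /andP[Gg ->]; rewrite gen_subG.
  by apply/subsetP=> x; rewrite inE; apply/allP: x.
rewrite big_distrl -sum_nat_const /=.
apply: leq_trans (_ : \sum_(A : {group gT} | A \proper G) #|G| ^ n <= _)%N.
  apply: leq_sum => A /andP[sAG nsGA].
  rewrite -(Lagrange sAG) expnMn leq_mul //; last first.
    by case: (posnP n) => [->//|n0]; rewrite leq_exp2r ?indexg_gt1.
  rewrite -card_tuples_in sum1_card subset_leq_card //.
  apply/subsetP=> g /andP[_ /eqP<-]; rewrite inE; apply/allP=> x gx.
  by rewrite mem_gen ?inE.
by rewrite [leqRHS](bigID (fun A : {group gT} => A \proper G)) leq_addr.
Qed.

(** * Probabilities *)

Local Open Scope classical_set_scope.
Local Open Scope ring_scope.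

Lemma word_prob_gt0 (R : numFieldType) (gT : finGroupType) (G : {group gT}) w :
  0 < word_prob R G w.
Proof.
rewrite divr_gt0 ?ltr0n ?expn_gt0 ?cardG_gt0 //; apply/card_gt0P.
exists [tuple of nseq (word_rank w) (1%g : gT)].
rewrite inE all_nseq group1 orbT /= /word_eval big1 // => l _.
have nth1 k : nth 1%g (nseq (word_rank w) (1%g : gT)) k = 1%g.
  by rewrite nth_nseq if_same.
by rewrite /letter_eval; case: l.2; rewrite [nth _ _ _]nth1 ?invg1.
Qed.

Theorem corollary8 (R : realType) (gT : finGroupType) (G : {group gT})
    (nsolG : ~~ solvable G) :
  limit_point (range (fun w : F_infty => word_prob R G w)) (0 : R).
Proof.
move=> U /nbhs_ballP[e /= e0 sub_U].
pose C := #|{: {group gT}}|%:R : R.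
(* As n < 2^n, an integer n above C / e makes C / 2^n smaller than e. *)
have Ce0 : 0 <= C / e by rewrite divr_ge0 // ltW.
pose n := Num.bound (C / e).
have C_lt : C < e * (2 ^ n)%:R.
  rewrite mulrC -ltr_pdivrMr // (lt_trans (archi_boundP Ce0)) //.
  by rewrite ltr_nat ltn_expl.
have Gn0 : 0 < (#|G| ^ n)%:R :> R by rewrite ltr0n expn_gt0 cardG_gt0.
have [w wn w_sol] := nonsolvable_detecting_word n gT.
have P_lt_e : word_prob R G w < e.
  rewrite -(word_prob_nE R G wn) ltr_pdivrMr //.
  have sub_S : word_solutions G n w \subset
      [set g : n.-tuple gT | all [in G] g & (<<[set x in g]>> != G)%g]%SET.
    apply/subsetP=> g; rewrite !inE => /andP[-> /eqP/w_sol solg] /=.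
    by apply: contraNneq nsolG => <-.
  have le_S := leq_trans (leq_mul (subset_leq_card sub_S) (leqnn (2 ^ n)))
    (card_nongenerating_tuples G n).
  rewrite -(@ltr_pM2r _ (2 ^ n)%:R) ?ltr0n ?expn_gt0 // -natrM.
  apply: le_lt_trans (_ : C * (#|G| ^ n)%:R < _); first by rewrite -natrM ler_nat.
  by rewrite mulrAC ltr_pM2r.
exists (word_prob R G w); split; first by rewrite gt_eqF ?word_prob_gt0.
  by exists w.
by apply: sub_U; rewrite /ball /= sub0r normrN gtr0_norm ?word_prob_gt0.
Qed.
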